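(* Let $A$ be an associative unital algebra over a field $\Bbbk$. Put $\mathfrak{X}_u:=\{X\in\mathrm{End}_\Bbbk(A)\mid X(1)=0\}$ with $A$-bimodule structure $(a\cdot X)(b):=aX(b)$, $(X\cdot a)(b):=X(ab)-X(a)b$ for $a,b\in A$, and let $\mathscr{L}^u\colon\mathfrak{X}_u\hookrightarrow\mathrm{End}_\Bbbk(A)$ be the canonical inclusion. Then $(\mathfrak{X}_u,\mathscr{L}^u)$ is a first order vector field calculus (FOVC) on $A$, and it has the following universal property: for every FOVC $(\mathfrak{X},\mathscr{L})$ on $A$ there is a morphism of FOVCi $(\mathfrak{X},\mathscr{L})\to(\mathfrak{X}_u,\mathscr{L}^u)$; explicitly, there exists an injective morphism $\Phi\colon\mathfrak{X}\to\mathfrak{X}_u$ of $A$-bimodules such that $\mathscr{L}=\mathscr{L}^u\circ\Phi$.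
   Context: A first order vector field calculus (FOVC, plural FOVCi) on an associative unital $\Bbbk$-algebra $A$ is a pair $(\mathfrak{X},\mathscr{L})$ where $\mathfrak{X}$ is an $A$-bimodule and $\mathscr{L}\colon\mathfrak{X}\to\mathrm{End}_\Bbbk(A)$, $X\mapsto\mathscr{L}_X$, is a $\Bbbk$-linear map which is injective, left $A$-linear (i.e. $\mathscr{L}_{a\cdot X}(b)=a\mathscr{L}_X(b)$) and satisfies the Leibniz rule $\mathscr{L}_X(ab)=\mathscr{L}_X(a)b+\mathscr{L}_{X\cdot a}(b)$ for all $X\in\mathfrak{X}$, $a,b\in A$. A morphism $(\mathfrak{X},\mathscr{L})\to(\mathfrak{X}',\mathscr{L}')$ of FOVCi on $A$ is an $A$-bimodule map $\Phi\colon\mathfrak{X}\to\mathfrak{X}'$ with $\mathscr{L}'\circ\Phi=\mathscr{L}$. *)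

(* Defs.v *)
From HB Require Import structures.
From mathcomp Require Import all_boot all_algebra.
From mathcomp Require Import boolp functions.

Set Implicit Arguments.
Unset Strict Implicit.
Unset Printing Implicit Defensive.
Import GRing.Theory.
Local Open Scope ring_scope.

(* Associative unital algebras, possibly zero.  The zero algebra is excluded
   from [algType], and Hierarchy Builder does not accept a common substructure
   of [pzRingType] and [lmodType k] declared after [algType]; hence a plain
   record, whose carrier is given both structures. *)
Record pzAlgType (k : fieldType) := PzAlgType {
  alg_ring : pzRingType;
  alg_scale : k -> alg_ring -> alg_ring;
  alg_scaleA : forall c d a, alg_scale c (alg_scale d a) = alg_scale (c * d) a;
  alg_scale1 : left_id 1 alg_scale;
  alg_scaleDr : right_distributive alg_scale +%R;
  alg_scaleDl : forall a, {morph alg_scale^~ a : c d / c + d};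
  alg_scaleAl : forall c a b, alg_scale c (a * b) = alg_scale c a * b;
  alg_scaleAr : forall c a b, alg_scale c (a * b) = a * alg_scale c b
}.

Definition alg_sort (k : fieldType) (A : pzAlgType k) : Type := alg_ring A.
Coercion alg_sort : pzAlgType >-> Sortclass.

HB.instance Definition _ (k : fieldType) (A : pzAlgType k) :=
  GRing.PzRing.copy (alg_sort A) (alg_ring A).
HB.instance Definition _ (k : fieldType) (A : pzAlgType k) :=
  GRing.Zmodule_isLmodule.Build k (alg_sort A)
    (@alg_scaleA k A) (@alg_scale1 k A) (@alg_scaleDr k A) (@alg_scaleDl k A).

Lemma pzscalerAl (k : fieldType) (A : pzAlgType k) (c : k) (a b : A) :
  c *: (a * b) = (c *: a) * b.
Proof. exact: alg_scaleAl. Qed.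

Lemma pzscalerAr (k : fieldType) (A : pzAlgType k) (c : k) (a b : A) :
  c *: (a * b) = a * (c *: b).
Proof. exact: alg_scaleAr. Qed.

Definition pzAlg_of_algType (k : fieldType) (A : algType k) : pzAlgType k :=
  PzAlgType (@scalerA k A) (@scale1r k A) (@scalerDr k A) (@scalerDl k A)
    (@scalerAl k A) (@scalerAr k A).

(* The vector space of linear maps, as a subspace of the space of functions. *)
Section LinearMaps.
Variables (k : fieldType) (U V : lmodType k).

Definition linear_pred : {pred U -> V} := fun f => `[< linear f >].

Lemma linear_predP (f : U -> V) : reflect (linear f) (f \in linear_pred).
Proof. exact: asboolP. Qed.

Definition linear_Sub (f : U -> V) (f_lin : f \in linear_pred) :
    {linear U -> V} :=
  HB.pack f (GRing.isLinear.Build k U V *:%R f (elimT (linear_predP f) f_lin)).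

Lemma linear_rect (K : {linear U -> V} -> Type) :
  (forall f (f_lin : f \in linear_pred), K (linear_Sub f_lin)) ->
  forall u, K u.
Proof.
move=> Ksub u.
have u_lin : (u : U -> V) \in linear_pred.
  by apply/linear_predP => c x y; rewrite linearP.
suff -> : u = linear_Sub u_lin by exact: Ksub.
case: u u_lin => f [[m] [s]] f_lin; rewrite /linear_Sub /=.
congr (GRing.Linear.Pack (GRing.Linear.Class _ _)).
  by case: (X in _ = X) => m'; rewrite (Prop_irrelevance m m').
by case: (X in _ = X) => s'; rewrite (Prop_irrelevance s s').
Qed.

Lemma linear_SubK (f : U -> V) (f_lin : f \in linear_pred) :
  linear_Sub f_lin = f :> (U -> V).
Proof. by []. Qed.

HB.instance Definition _ :=
  isSub.Build (U -> V) linear_pred {linear U -> V} linear_rect linear_SubK.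
HB.instance Definition _ := [Choice of {linear U -> V} by <:].

Lemma linear_pred_closed : submod_closed linear_pred.
Proof.
split=> [|a f g /linear_predP f_lin /linear_predP g_lin].
  by apply/linear_predP => c x y; rewrite /= scaler0 addr0.
apply/linear_predP => c x y.
have E z : (a *: f + g) z = a *: f z + g z by [].
by rewrite !E f_lin g_lin !scalerDr !scalerA [a * c]mulrC addrACA.
Qed.

HB.instance Definition _ :=
  GRing.isSubmodClosed.Build k (U -> V) linear_pred linear_pred_closed.
HB.instance Definition _ :=
  [SubChoice_isSubLmodule of {linear U -> V} by <:].

End LinearMaps.

Section FOVC.
Variables (k : fieldType) (A : pzAlgType k).

Record is_bimodule (M : lmodType k) (lact : A -> M -> M) (ract : M -> A -> M) :
    Prop := IsBimodule {
  lact_linearl : forall x, linear (lact^~ x);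
  lact_linearr : forall a, linear (lact a);
  ract_linearl : forall a, linear (ract^~ a);
  ract_linearr : forall x, linear (ract x);
  lact1 : forall x, lact 1 x = x;
  lactM : forall a b x, lact (a * b) x = lact a (lact b x);
  ract1 : forall x, ract x 1 = x;
  ractM : forall x a b, ract x (a * b) = ract (ract x a) b;
  lactrA : forall a x b, ract (lact a x) b = lact a (ract x b)
}.

(* The data of an FOVC, without its axioms, which are in [is_fovc]. *)
Record fovc_data := FovcData {
  vfield :> lmodType k;
  lact : A -> vfield -> vfield;
  ract : vfield -> A -> vfield;
  lie : vfield -> {linear A -> A}
}.

Record is_fovc (F : fovc_data) : Prop := IsFovc {
  fovc_bimodule : is_bimodule (@lact F) (@ract F);
  lie_linear : linear (@lie F);
  lie_inj : injective (@lie F);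
  lie_lact : forall (a : A) (X : F) (b : A), lie (lact a X) b = a * lie X b;
  lie_leibniz : forall (X : F) (a b : A),
    lie X (a * b) = lie X a * b + lie (ract X a) b
}.

Record is_bimodule_morphism (F G : fovc_data) (Phi : F -> G) : Prop :=
  IsBimoduleMorphism {
  bimod_morph_linear : linear Phi;
  bimod_morph_lact : forall a X, Phi (lact a X) = lact a (Phi X);
  bimod_morph_ract : forall X a, Phi (ract X a) = ract (Phi X) a
}.

Record is_fovc_morphism (F G : fovc_data) (Phi : F -> G) : Prop :=
  IsFovcMorphism {
  fovc_morph_bimod : is_bimodule_morphism Phi;
  fovc_morph_lie : forall X, lie (Phi X) = lie X
}.

Definition kills1 : {pred {linear A -> A}} := fun X => X 1 == 0.

Lemma kills1_closed : submod_closed kills1.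
Proof.
split=> [|c X Y /eqP X1 /eqP Y1]; apply/eqP => //.
by rewrite -[LHS]/(c *: X 1 + Y 1) X1 Y1 scaler0 addr0.
Qed.

HB.instance Definition _ :=
  GRing.isSubmodClosed.Build k {linear A -> A} kills1 kills1_closed.

Record univ_vfield := UnivVfield {
  univ_lie : {linear A -> A};
  univ_lieP : univ_lie \in kills1
}.

HB.instance Definition _ := [isSub for univ_lie].
HB.instance Definition _ := [Choice of univ_vfield by <:].
HB.instance Definition _ := [SubChoice_isSubLmodule of univ_vfield by <:].

Definition univ_lact_fun (a : A) (X : {linear A -> A}) (b : A) : A := a * X b.

Definition univ_ract_fun (X : {linear A -> A}) (a b : A) : A :=
  X (a * b) - X a * b.

Lemma univ_lact_fun_linear a X : linear (univ_lact_fun a X).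
Proof. by move=> c x y; rewrite /univ_lact_fun linearP mulrDr pzscalerAr. Qed.

Lemma univ_ract_fun_linear X a : linear (univ_ract_fun X a).
Proof.
move=> c x y; rewrite /univ_ract_fun !mulrDr -!pzscalerAr linearP.
by rewrite scalerBr opprD addrACA.
Qed.

HB.instance Definition _ a X :=
  GRing.isLinear.Build k A A *:%R (univ_lact_fun a X)
    (univ_lact_fun_linear a X).
HB.instance Definition _ X a :=
  GRing.isLinear.Build k A A *:%R (univ_ract_fun X a)
    (univ_ract_fun_linear X a).

Lemma univ_lactP a (X : univ_vfield) :
  (univ_lact_fun a (univ_lie X) : {linear A -> A}) \in kills1.
Proof.
by apply/eqP; rewrite /= /univ_lact_fun (eqP (univ_lieP X)) mulr0.
Qed.

Lemma univ_ractP (X : univ_vfield) a :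
  (univ_ract_fun (univ_lie X) a : {linear A -> A}) \in kills1.
Proof. by apply/eqP; rewrite /= /univ_ract_fun !mulr1 subrr. Qed.

Definition univ_lact (a : A) (X : univ_vfield) : univ_vfield :=
  UnivVfield (univ_lactP a X).

Definition univ_ract (X : univ_vfield) (a : A) : univ_vfield :=
  UnivVfield (univ_ractP X a).

Definition univ_fovc : fovc_data := FovcData univ_lact univ_ract univ_lie.

End FOVC.

(* Main.v *)
Require Import Defs.
From mathcomp Require Import all_boot all_algebra.
From mathcomp Require Import boolp.

Import GRing.Theory.
Local Open Scope ring_scope.

(** The universal calculus is a calculus by direct computation: two elements
    of [univ_vfield A] are equal as soon as they agree at every [b : A]
    ([univ_vfield_ext]), and every bimodule axiom evaluated at [b] is an
    identity in [A].  The right action [(X . a)(b) = X (a b) - X a b] is the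
    Leibniz rule solved for [X . a].

    Universality rests on two consequences of the Leibniz rule in an arbitrary
    calculus.  At [a = b = 1], the equality [X . 1 = X] yields
    [L_X 1 = L_X 1 + L_X 1], so that every [L_X] kills [1] ([lie1]) and [L]
    takes its values in the universal vector fields.  Moreover, the Leibniz
    rule forces [L_(X . a)] to be the universal right action of [a] on [L_X],
    so that the corestriction of [L] is a bimodule map; it is injective because
    [L] is. *)

Section Universal.
Variables (k : fieldType) (A : pzAlgType k).

Lemma univ_vfield_ext (X Y : univ_vfield A) :
  (forall b, univ_lie X b = univ_lie Y b) -> X = Y.
Proof. by move=> XY; apply: val_inj; apply: val_inj; apply: funext. Qed.

Lemma univ_lieE (c : k) (X Y : univ_vfield A) (b : A) :
  univ_lie (c *: X + Y) b = c *: univ_lie X b + univ_lie Y b.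
Proof. by []. Qed.

Lemma univ_lactE (a : A) (X : univ_vfield A) (b : A) :
  univ_lie (univ_lact a X) b = a * univ_lie X b.
Proof. by []. Qed.

Lemma univ_ractE (X : univ_vfield A) (a b : A) :
  univ_lie (univ_ract X a) b = univ_lie X (a * b) - univ_lie X a * b.
Proof. by []. Qed.

Lemma univ_bimodule : is_bimodule (@univ_lact k A) (@univ_ract k A).
Proof.
split.
- move=> X c a a'; apply: univ_vfield_ext => b.
  by rewrite univ_lieE !univ_lactE mulrDl pzscalerAl.
- move=> a c X Y; apply: univ_vfield_ext => b.
  by rewrite univ_lieE !univ_lactE univ_lieE mulrDr pzscalerAr.
- move=> a c X Y; apply: univ_vfield_ext => b.
  rewrite univ_lieE !univ_ractE !univ_lieE mulrDl -pzscalerAl scalerBr opprD.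
  by rewrite addrACA.
- move=> X c a a'; apply: univ_vfield_ext => b.
  rewrite univ_lieE !univ_ractE mulrDl -pzscalerAl !linearP mulrDl.
  by rewrite -pzscalerAl scalerBr opprD addrACA.
- by move=> X; apply: univ_vfield_ext => b; rewrite univ_lactE mul1r.
- by move=> a a' X; apply: univ_vfield_ext => b; rewrite !univ_lactE mulrA.
- move=> X; apply: univ_vfield_ext => b.
  by rewrite univ_ractE mul1r (eqP (univ_lieP X)) mul0r subr0.
(* In [X . a . a'], the two occurrences of [X a * (a' * b)] cancel. *)
- move=> X a a'; apply: univ_vfield_ext => b.
  by rewrite !univ_ractE mulrBl opprB addrA !mulrA subrK.
- move=> a X a'; apply: univ_vfield_ext => b.
  by rewrite univ_ractE !univ_lactE univ_ractE mulrBr mulrA.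
Qed.

Lemma univ_is_fovc : is_fovc (univ_fovc A).
Proof.
split=> //.
- exact: univ_bimodule.
- by move=> X Y XY; apply: val_inj.
- by move=> X a b; rewrite /= univ_ractE addrC subrK.
Qed.

Section Corestriction.
Variables (F : fovc_data A) (F_fovc : is_fovc F).

(** The Leibniz rule at [a = b = 1] reads [L_X 1 = L_X 1 + L_X 1], because the
    right action of [1] is the identity. *)
Lemma lie1 (X : F) : lie X \in @kills1 k A.
Proof.
have [bimodF _ _ _ leibniz] := F_fovc.
have := leibniz X 1 1; rewrite !mulr1 (ract1 bimodF) => E.
by apply/eqP; apply: (addrI (lie X 1)); rewrite addr0 -E.
Qed.

Definition lie_corestr (X : F) : univ_fovc A := UnivVfield (lie1 X).

Lemma lie_corestr_inj : injective lie_corestr.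
Proof.
by move=> X Y /(congr1 (@univ_lie k A)); apply: (lie_inj F_fovc).
Qed.

Lemma lie_corestr_morphism : is_fovc_morphism lie_corestr.
Proof.
have [_ lieP _ lie_lactE leibniz] := F_fovc.
split=> //; split.
- by move=> c X Y; apply: val_inj; apply: lieP.
- by move=> a X; apply: univ_vfield_ext => b; apply: lie_lactE.
- move=> X a; apply: univ_vfield_ext => b.
  by rewrite /= /univ_ract_fun leibniz addrC addKr.
Qed.

End Corestriction.
End Universal.

Theorem proposition2p3 (k : fieldType) (A : pzAlgType k) :
  is_fovc (univ_fovc A) /\
  forall F : fovc_data A, is_fovc F ->
    exists Phi : F -> univ_fovc A, is_fovc_morphism Phi /\ injective Phi.
Proof.
split=> [|F F_fovc]; first exact: univ_is_fovc.
exists (@lie_corestr k A F F_fovc).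
by split; [apply: lie_corestr_morphism | apply: lie_corestr_inj].
Qed.
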